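(* Let $\mathcal X$ be a space of examples, let $\mathcal H$ be a class of hypotheses over $\mathcal X$ with VC dimension $d$, and let $Q$ be a family of queries. Let $s(n)$ be the query dimension of $(\mathcal H,Q)$. (i) For any deterministic active learner $\mathcal A$, there is a subset $S\subseteq\mathcal X$ of $n$ examples such that if $\mathcal A$ makes less than $s(n)$ queries, then there are some $h^*\in\mathcal H$ and some $x\in S$ such that $\mathcal A$ labels $x$ incorrectly. (ii) There is an active learner $\mathcal A$ such that, for every subset $S\subseteq\mathcal X$ of $n$ examples and every $h^*\in\mathcal H$, $\mathcal A$ makes $O(s(n)\,d\log n)$ queries from $Q$ and labels every example in $S$ correctly.
   Context: Setting. Hypotheses are functions $\mathcal X\to\{\pm1\}$; an unknown target $h^*\in\mathcal H$ assigns each $x$ its true label $h^*(x)$. A region query is a pair $(T,z)$ with $T\subseteq\mathcal X$, $z\in\{\pm1\}$; a family of queries $Q$ is a set of region queries. The labeler has a labeling domain $L$ with $S\subseteq L\subseteq\mathcal X$ and answers $(T,z)$ with $1$ if every $x\in T\cap L$ has label $z$, and with $0$ otherwise; if $T\cap L=\emptyset$ an arbitrary answer may be returned. An active learner is given $\mathcal H$, the dataset $S$ and $Q$, adaptively submits queries from $Q$, and finally labels the examples of $S$. For a query $q\in Q$ and $h\in\mathcal H$, $q(h)\in\{0,1\}$ denotes the answer to $q$ when the target hypothesis is $h$. Partial labeling. A partial labeling over $S$ is a function $f:S'\to\{\pm1\}$ with $S'\subseteq S$. $\mathcal H_f=\{h\in\mathcal H\mid h(x)=f(x)\ \forall x\in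 S'\}$ is the set of its extensions in $\mathcal H$. Generalized teaching tree. For a set $S$ of $n$ examples and a partial labeling $f$ over $S$, a generalized teaching tree $T_f$ for $f$ is a binary tree such that: each node $v$ is associated with a subset $H_v\subseteq\mathcal H$, the root with $\mathcal H$; each internal node $v$ is also associated with a query $q_v\in Q$; the left and right children $v_l,v_r$ of an internal node $v$ satisfy $H_{v_l}=\{h\in H_v\mid q_v(h)=0\}$ and $H_{v_r}=\{h\in H_v\mid q_v(h)=1\}$; and for each leaf $v$, $H_v$ is either a subset of $\mathcal H_f$ or a subset of $\mathcal H\setminus\mathcal H_f$. Query dimension. For $n\in\mathbb N^+$, $$s(n)=\max_{S\subseteq\mathcal X,\ |S|=n}\ \max_{f\text{ partial labeling over }S}\ \min\{\mathrm{depth}(T_f)\mid T_f\text{ a generalized teaching tree for }f\}.$$ *)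

(* Defs.v *)
From mathcomp Require Import all_boot all_order all_algebra.
From mathcomp Require Import all_classical all_reals all_analysis.

Set Implicit Arguments.
Unset Strict Implicit.
Unset Printing Implicit Defensive.

Local Open Scope classical_set_scope.

(* The label +1 is [true] and the label -1 is [false]; the answer 1 to a query
   is [true] and the answer 0 is [false]. *)
Definition hypothesis (X : Type) := X -> bool.

Definition region_query (X : Type) := (set X * bool)%type.

Definition shattered (X : Type) (H : set (hypothesis X)) (A : set X) : Prop :=
  forall g : X -> bool, exists2 h, H h & forall x, A x -> h x = g x.

(* The VC dimension is finite and equal to [d]; in particular [H] is nonempty,
   since it shatters the empty set. *)
Definition VC_dimension (X : Type) (H : set (hypothesis X)) (d : nat) : Prop :=
  (exists2 A : set X, (A #= `I_d)%card & shattered H A) /\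
  (forall (m : nat) (A : set X),
     (A #= `I_m)%card -> shattered H A -> (m <= d)%N).

(* [L S] is the labeling domain used for the dataset [S], and [ans S q h] is the
   answer q(h) for the dataset [S].  Nothing is required of the answer to
   (T, z) when T does not meet [L S], beyond being a function of the dataset,
   the query and the target. *)
Definition labeler (X : Type) (L : set X -> set X)
    (ans : set X -> region_query X -> hypothesis X -> bool) : Prop :=
  (forall S : set X, S `<=` L S) /\
  (forall (S T : set X) (z : bool) (h : hypothesis X), T `&` L S !=set0 ->
     ans S (T, z) h <-> (forall x, (T `&` L S) x -> h x = z)).

(* A partial labeling S' -> {-1, +1} is a function to [option bool] that is
   [None] exactly outside S'. *)
Definition partial_labeling (X : Type) (S : set X) (f : X -> option bool) : Prop :=
  [set x | f x != None] `<=` S.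

Definition extensions (X : Type) (H : set (hypothesis X)) (f : X -> option bool) :
    set (hypothesis X) :=
  [set h | H h /\ forall x b, f x = Some b -> h x = b].

Inductive query_tree (X : Type) : Type :=
| Leaf
| Node of region_query X & query_tree X & query_tree X.

Fixpoint depth (X : Type) (t : query_tree X) : nat :=
  match t with
  | Leaf => 0
  | Node _ l r => (maxn (depth l) (depth r)).+1
  end.

(* [Hv] is the set of hypotheses associated with the root of [t]; those of the
   other nodes are determined by it. *)
Fixpoint teaching_subtree (X : Type) (H : set (hypothesis X))
    (Q : set (region_query X)) (o : region_query X -> hypothesis X -> bool)
    (f : X -> option bool) (Hv : set (hypothesis X)) (t : query_tree X) : Prop :=
  match t with
  | Leaf => Hv `<=` extensions H f \/ Hv `<=` H `\` extensions H f
  | Node q l r =>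
      [/\ Q q,
          teaching_subtree H Q o f [set h | Hv h /\ o q h = false] l &
          teaching_subtree H Q o f [set h | Hv h /\ o q h = true] r]
  end.

Definition teaching_tree (X : Type) (H : set (hypothesis X))
    (Q : set (region_query X)) (o : region_query X -> hypothesis X -> bool)
    (f : X -> option bool) (t : query_tree X) : Prop :=
  teaching_subtree H Q o f H t.

Definition min_depth (X : Type) (H : set (hypothesis X))
    (Q : set (region_query X)) (o : region_query X -> hypothesis X -> bool)
    (f : X -> option bool) (k : nat) : Prop :=
  (exists2 t, teaching_tree H Q o f t & depth t = k) /\
  (forall t, teaching_tree H Q o f t -> (k <= depth t)%N).

(* The maximum over (S, f) of the minimal depths exists in nat and equals [s]. *)
Definition query_dimension (X : Type) (H : set (hypothesis X))
    (Q : set (region_query X))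
    (ans : set X -> region_query X -> hypothesis X -> bool) (n s : nat) : Prop :=
  (exists (S : set X) (f : X -> option bool),
     [/\ (S #= `I_n)%card, partial_labeling S f & min_depth H Q (ans S) f s]) /\
  (forall (S : set X) (f : X -> option bool),
     (S #= `I_n)%card -> partial_labeling S f ->
     exists2 k, min_depth H Q (ans S) f k & (k <= s)%N).

(* Given the dataset and the answers received so far (oldest first), a
   deterministic learner either submits a query or stops with a labeling, of
   which only the values on the dataset matter. It need not stop. *)
Record active_learner (X : Type) (Q : set (region_query X)) := ActiveLearner {
  act : set X -> seq bool -> region_query X + (X -> bool);
  act_query : forall S w q, act S w = inl q -> Q q
}.

(* [run a o w m g]: from the answers [w], the learner makes exactly [m] further
   queries, answered by [o], and then stops with the labeling [g]. *)
Inductive run (X : Type) (a : seq bool -> region_query X + (X -> bool))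
    (o : region_query X -> bool) : seq bool -> nat -> (X -> bool) -> Prop :=
| run_stop w g : a w = inr g -> run a o w 0 g
| run_ask w q m g : a w = inl q -> run a o (rcons w (o q)) m g ->
    run a o w m.+1 g.

Definition outcome (X : Type) (Q : set (region_query X))
    (ans : set X -> region_query X -> hypothesis X -> bool)
    (A : active_learner Q) (S : set X) (h : hypothesis X)
    (m : nat) (g : X -> bool) : Prop :=
  run (act A S) (fun q => ans S q h) [::] m g.

(* Main.v *)
Require Import Defs.
From mathcomp Require Import all_boot all_order all_algebra.
From mathcomp Require Import all_classical all_reals all_analysis.
From mathcomp Require Import zify.

Set Implicit Arguments.
Unset Strict Implicit.
Unset Printing Implicit Defensive.

Import Order.TTheory GRing.Theory Num.Theory.

(** Lower bound: a learner that is always correct within k queries unrolls into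
    a teaching tree of depth at most k for every partial labeling of S, because
    the labeling it outputs at a leaf decides whether the target extends f.

    Upper bound: let V be the set of labelings of S that are still possible.
    Fixing the majority labels of points on which V disagrees, one point after
    the other, at most halves the number of compatible labelings each time, so
    some partial labeling f is extended by between 1/4 and 3/4 of V. A teaching
    tree for f tells, with at most s queries, which part contains the target.
    By the Sauer-Shelah lemma V has at most (n + 1) ^ d elements initially, so
    O(d log n) such rounds suffice. *)

(** * Finite set families: shattered sets and balanced partial labelings *)

Section FiniteSets.
Import boot.fintype boot.finset.

Definition trace_shatters (T : finType) (F : {set {set T}}) (A : {set T}) :=
  [forall B in powerset A, B \in [set C :&: A | C in F]].

(* Pajor's form of the Sauer-Shelah lemma. *)
Lemma card_shattered_sets (T : finType) (F : {set {set T}}) :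
  #|F| <= #|[set A | trace_shatters F A]|.
Proof.
have [n] := ubnP #|F|; elim: n F => // n IHn F ltFn.
have shP (G : {set {set T}}) (A : {set T}) : reflect (forall B : {set T}, B \subset A -> exists2 C, C \in G & B = C :&: A)
    (trace_shatters G A).
  apply: (iffP forallP) => [sh B sBA | sh B].
    by have /implyP/(_ _)/imsetP[|C ? ?] := sh B; [rewrite powersetE | exists C].
  apply/implyP; rewrite powersetE => /sh[C CG ->]; exact: imset_f.
have [cF|] := leqP #|F| 1.
  case: (posnP #|F|) => [->//|F0]; have/card_gt0P[C CF] := F0.
  apply: leq_trans cF _; apply/card_gt0P; exists set0; rewrite inE; apply/shP => B.
  by rewrite subset0 => /eqP->; exists C => //; rewrite setI0.
case/card_gt1P=> C1 [C2 [C1F C2F neC]].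
have [x xP] : exists x, (x \in C1) != (x \in C2).
  apply/existsP; apply: contra_neqT neC => /existsPn eqC.
  by apply/setP => x; apply/eqP; have := eqC x; rewrite negbK.
(* Each half has fewer members than [F], and whatever it shatters avoids [x], since its members
   agree at [x]. *)
pose F1 := [set C in F | x \in C]; pose F0 := [set C in F | x \notin C].
have cF : #|F| = #|F1| + #|F0|.
  rewrite -(cardsID [set C : {set T} | x \in C] F); congr (_ + _); apply: eq_card => /= C;
    by rewrite !inE // andbC.
have lt0 : 0 < #|F0|.
  apply/card_gt0P; case x1 : (x \in C1) xP => x2; [exists C2 | exists C1];
  by rewrite inE ?C2F ?C1F ?x1 //; case: (x \in C2) x2.
have lt1 : 0 < #|F1|.
  apply/card_gt0P; case x1 : (x \in C1) xP => x2; [exists C1 | exists C2];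
  by rewrite inE ?C2F ?C1F ?x1 //; case: (x \in C2) x2.
have xS1 A : trace_shatters F1 A -> x \notin A.
  move/shP/(_ set0 (sub0set _)) => [C]; rewrite inE => /andP[_ xC] /setP/(_ x).
  by rewrite !inE xC => /= <-.
have xS0 A : trace_shatters F0 A -> x \notin A.
  move/shP/(_ A (subxx _)) => [C]; rewrite inE => /andP[_ xC] /setP/(_ x).
  by rewrite !inE (negbTE xC) => ->.
pose S0 := [set A | trace_shatters F0 A]; pose S1 := [set A | trace_shatters F1 A].
rewrite cF; apply: (@leq_trans (#|S1| + #|S0|)).
  by apply: leq_add; apply: IHn; lia.
(* A set [A] shattered by both halves is counted twice; its second copy is exchanged for [x |: A],
   which [F] shatters and which lies outside [S0] and [S1]. *)
rewrite -cardsUI.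
have -> : #|S1 :&: S0| = #|[set x |: A | A in S1 :&: S0]|.
  rewrite card_in_imset // => A B; rewrite !inE => /andP[/xS1 xA _] /andP[/xS1 xB _].
  by move=> eAB; rewrite -(setU1K xA) eAB setU1K.
rewrite -cardsUI [X in _ + X](_ : _ = 0) ?addn0; last first.
  apply/eqP; rewrite cards_eq0 -subset0; apply/subsetP => A; rewrite !inE.
  by case/andP=> /orP[/xS1|/xS0] + /imsetP[B _ eA]; rewrite eA !inE eqxx.
apply: subset_leq_card; apply/subsetP => A; rewrite !inE => /orP[/orP[]|].
- move=> /shP sh; apply/shP => B /sh[C]; rewrite inE => /andP[CF _] ->.
  by exists C.
- move=> /shP sh; apply/shP => B /sh[C]; rewrite inE => /andP[CF _] ->.
  by exists C.
case/imsetP=> D; rewrite !inE => /andP[/[dup] /xS1 xD /shP sh1 /shP sh0] ->.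
apply/shP => B sB.
have sBD : B :\ x \subset D by rewrite subDset.
case xB : (x \in B).
  have [C] := sh1 _ sBD; rewrite inE => /andP[CF xC] eB; exists C => //.
  by rewrite setIUr -eB (setIidPr _) ?sub1set // setD1K.
have [C] := sh0 _ sBD; rewrite inE => /andP[CF xC] eB; exists C => //.
apply/setP => y; have/setP/(_ y) := eB; rewrite !inE.
by case: eqVneq => [->|_] //= _; rewrite xB (negbTE xC).
Qed.

(* A set of at most d elements is the range of a partial map from 'I_d. *)
Lemma card_sets_of_card_le (T : finType) d :
  #|[set A : {set T} | #|A| <= d]| <= #|T|.+1 ^ d.
Proof.
have -> : (#|T|.+1 ^ d = #|{ffun 'I_d -> option T}|)%N.
  by rewrite card_ffun card_option card_ord.
pose range (u : {ffun 'I_d -> option T}) := [set y | Some y \in codom u].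
apply: leq_trans (leq_imset_card range _).
apply: subset_leq_card; apply/subsetP => A; rewrite inE => cA.
apply/imsetP; exists [ffun i : 'I_d => onth (enum A) i] => //.
apply/setP => y; rewrite inE -mem_enum; apply/idP/codomP => [yA | [i]].
  have lty : index y (enum A) < d.
    by apply: leq_trans cA; rewrite cardE index_mem.
  exists (Ordinal lty); rewrite ffunE /=.
  by rewrite onthE (nth_map y) ?index_mem // nth_index.
by rewrite ffunE => yi; apply/onthP; exists i.
Qed.

(** A labeling of [T] is encoded as the set of its positive points. *)
Definition extends_labels (T : finType) (f : T -> option bool) (A : {set T}) :=
  [forall x, if f x is Some b then (x \in A) == b else true].

(** As long as the share of compatible labelings exceeds 3/4, keeping a majority leaves more than
    3/8, so the first share not above 3/4 is still at least 1/4. *)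
Lemma balanced_partial_labeling (T : finType) (V : {set {set T}}) : 1 < #|V| ->
  exists f : T -> option bool,
    #|V| <= 4 * #|[set A in V | extends_labels f A]| <= 3 * #|V|.
Proof.
move=> V1.
suff H n f : #|[set A in V | extends_labels f A]| < n ->
    #|V| <= 4 * #|[set A in V | extends_labels f A]| ->
    exists f, #|V| <= 4 * #|[set A in V | extends_labels f A]| <= 3 * #|V|.
  apply: (H #|V|.+1 (fun=> None)).
    by rewrite ltnS; apply: subset_leq_card; apply/subsetP => A; rewrite inE => /andP[].
  apply: leq_trans (leq_pmull _ _) _; first exact: (ltn0Sn 3).
  rewrite leq_pmul2l //; apply: subset_leq_card; apply/subsetP => A AV.
  by rewrite inE AV /=; apply/forallP.
elim: n f => // n IHn f; set W := [set A in V | _] => ltW leVW.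
have [le3|gt3] := leqP (4 * #|W|) (3 * #|V|); first by exists f; rewrite leVW.
have : 1 < #|W| by lia.
case/card_gt1P=> A [B [AW BW neAB]].
have [x xP] : exists x, (x \in A) != (x \in B).
  apply/existsP; apply: contra_neqT neAB => /existsPn eqC.
  by apply/setP => x; apply/eqP; have := eqC x; rewrite negbK.
have fx : f x = None.
  move: AW BW; rewrite !inE => /andP[_ /forallP/(_ x)] + /andP[_ /forallP/(_ x)].
  by case: (f x) => // b /eqP xA /eqP xB; rewrite xA xB eqxx in xP.
pose g b y := if y == x then Some b else f y.
have eW b : [set C in V | extends_labels (g b) C] = [set C in W | (x \in C) == b].
  apply/setP => C; rewrite !inE -andbA; congr (_ && _).
  apply/forallP/andP => [all | [/forallP all xC] y].
    split; last by have := all x; rewrite /g eqxx.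
    by apply/forallP => y; have := all y; rewrite /g; case: eqP => // ->; rewrite fx.
  by rewrite /g; case: eqP => [->//|_]; exact: all.
pose W_ (b : bool) := [set C in W | (x \in C) == b].
have cW : #|W| = #|W_ true| + #|W_ false|.
  rewrite -(cardsID [set C : {set T} | x \in C] W); congr (_ + _); apply: eq_card => /= C;
    by rewrite !inE ?eqb_id ?eqbF_neg // andbC.
(* Both labels occur at [x], so the majority half is strictly smaller than [W] and the induction on
   [n] goes through. *)
have W0 b : 0 < #|W_ b|.
  apply/card_gt0P; have [xA|xA] := eqVneq (x \in A) b.
    by exists A; rewrite inE AW xA /=.
  by exists B; rewrite inE BW /=; move: xA xP; case: b (x \in A) (x \in B) => [] [] [].
have [b le2] : exists b, #|W| <= 2 * #|W_ b|.
  by have [le|lt] := leqP #|W_ true| #|W_ false|; [exists false | exists true]; lia.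
apply: (IHn (g b)); rewrite eW -/(W_ b); last lia.
rewrite ltnS in ltW; apply: leq_trans ltW; rewrite cW; have := W0 (~~ b).
case: b {le2} => /= W0b; first by rewrite -addn1 leq_add2l; exact: W0b.
by rewrite addnC -addn1 leq_add2l; exact: W0b.
Qed.

End FiniteSets.

Definition trace (X : Type) n (e : 'I_n -> X) (h : X -> bool) : {set 'I_n} :=
  [set i | h (e i)].

Local Open Scope classical_set_scope.

(** * Learners and trees: unrolling a learner, running a tree, grafting trees *)

Section Strategies.
Variable X : Type.
Implicit Types (H Hv U : set (hypothesis X)) (Q : set (region_query X)).
Implicit Types (o : region_query X -> hypothesis X -> bool).

(** The fuel [k] is there because a learner need not stop; a branch that exhausts it ends in a
    leaf. *)
Fixpoint unroll (a : seq bool -> region_query X + (X -> bool)) (k : nat)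
    (w : seq bool) : query_tree X :=
  match k, a w with
  | k'.+1, inl q => Node q (unroll a k' (rcons w false)) (unroll a k' (rcons w true))
  | _, _ => Leaf X
  end.

Lemma depth_unroll a k w : depth (unroll a k w) <= k.
Proof. by elim: k w => [|k IHk] w //=; case: (a w) => //= q; rewrite ltnS geq_max !IHk. Qed.

Lemma run_stopE a (p : region_query X -> bool) w g m g' :
  a w = inr g -> @run X a p w m g' -> g' = g.
Proof. by move=> awg r; case: r awg => [? ? -> []|? ? ? ? -> ]. Qed.

Lemma run_askE a (p : region_query X -> bool) w q m g :
  a w = inl q -> @run X a p w m g ->
  exists2 m', m = m'.+1 & run a p (rcons w (p q)) m' g.
Proof.
by move=> awq r; case: r awq => [? ? ->|v q' m' ? -> r [<-]] //; exists m'.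
Qed.

(** All of [Hv] agrees with [g] on [S], so [g] alone settles whether a member extends [f]. *)
Lemma decided_by_labeling H (S : set X) f (g : X -> bool) Hv :
    partial_labeling S f -> Hv `<=` H ->
    (forall h, Hv h -> forall x, S x -> g x = h x) ->
  Hv `<=` extensions H f \/ Hv `<=` H `\` extensions H f.
Proof.
move=> Sf HvH eq_g.
have Sfx x b : f x = Some b -> S x by move=> fx; apply: Sf; rewrite /= fx.
have [gf|gf] := pselect (forall x b, f x = Some b -> g x = b); [left|right].
  move=> h hv; split=> [|x b fx]; first exact: HvH.
  by rewrite -(eq_g h) ?(gf _ _ fx) //; exact: Sfx fx.
move=> h hv; split=> [|[_ hf]]; first exact: HvH.
by apply: gf => x b fx; rewrite (eq_g h) ?(hf _ _ fx) //; exact: Sfx fx.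
Qed.

Lemma teaching_subtree_unroll H Q o (S : set X) f a k w Hv :
    (forall v q, a v = inl q -> Q q) -> partial_labeling S f -> Hv `<=` H ->
    (forall h, Hv h -> exists m g,
       [/\ run a (o^~ h) w m g, m <= k & forall x, S x -> g x = h x]) ->
  teaching_subtree H Q o f Hv (unroll a k w).
Proof.
move=> aQ Sf; elim: k w Hv => [|k IHk] w Hv HvH correct /=.
all: case aw : (a w) => [q|g]; last by
  apply: (decided_by_labeling (g := g) Sf HvH) => h;
  case/correct=> m [g' [/(run_stopE aw) -> _]].
  (* No fuel is left but a query is pending: no target has a run of length 0, so [Hv] is empty and
     either alternative holds. *)
  by left=> h /correct[m [g [/(run_askE aw)[m' ->]]]].
split; first exact: aQ aw.
all: apply: IHk => [h [/HvH]//|h [/correct[m [g []]]]].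
all: by move=> /(run_askE aw)[m' -> r] lem eq_g oq; exists m', g; rewrite -oq.
Qed.

Inductive decision_tree :=
| Stop of X -> bool
| Ask of region_query X & decision_tree & decision_tree.

Fixpoint decision_depth t :=
  if t is Ask _ l r then (maxn (decision_depth l) (decision_depth r)).+1 else 0.

Fixpoint asks_within Q t :=
  if t is Ask q l r then [/\ Q q, asks_within Q l & asks_within Q r] else True.

Fixpoint decide (p : region_query X -> bool) t :=
  match t with
  | Stop g => g
  | Ask q l r => if p q then decide p r else decide p l
  end.

(** Replaying the recorded answers from the root turns a tree into a function of the answer history,
    the form of [act]. *)
Fixpoint follow t (w : seq bool) : region_query X + (X -> bool) :=
  match t, w with
  | Stop g, _ => inr g
  | Ask q _ _, [::] => inl q
  | Ask _ l r, b :: w' => if b then follow r w' else follow l w'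
  end.

Lemma follow_query Q t w q : asks_within Q t -> follow t w = inl q -> Q q.
Proof.
elim: t w => [//|q' l IHl r IHr] [|b w] /= [Qq Ql Qr]; first by case=> <-.
by case: b; [exact: IHr | exact: IHl].
Qed.

Lemma run_follow (p : region_query X -> bool) a w t : (forall v, a (w ++ v) = follow t v) ->
  exists2 m, m <= decision_depth t & run a p w m (decide p t).
Proof.
elim: t w => [g|q l IHl r IHr] w aw /=.
  by exists 0 => //; apply: run_stop; rewrite -(cats0 w) aw.
have aw0 : a w = inl q by rewrite -(cats0 w) aw.
case oq : (p q).
  have [|m lem rm] := IHr (rcons w true); first by move=> v; rewrite cat_rcons aw.
  by exists m.+1; [rewrite ltnS leq_max lem orbT | apply: run_ask aw0 _; rewrite oq].
have [|m lem rm] := IHl (rcons w false); first by move=> v; rewrite cat_rcons aw.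
by exists m.+1; [rewrite ltnS leq_max lem | apply: run_ask aw0 _; rewrite oq].
Qed.

Definition learnable Q o (S : set X) U k := exists t,
  [/\ asks_within Q t, decision_depth t <= k
    & forall h, U h -> forall x, S x -> decide (o^~ h) t x = h x].

Lemma learnable_sub Q o S U U' k k' : learnable Q o S U k ->
  U' `<=` U -> k <= k' -> learnable Q o S U' k'.
Proof.
move=> [t [Qt dt Ut]] sU lek; exists t; split=> //; first exact: leq_trans lek.
by move=> h /sU; exact: Ut.
Qed.

(** Each leaf of [t] decides whether its targets extend [f]; the tree for that case is grafted
    there, so depths add. *)
Lemma learnable_teaching H Q o S f U Hv t k :
    teaching_subtree H Q o f Hv t ->
    learnable Q o S (U `&` extensions H f) k ->
    learnable Q o S (U `&` ~` extensions H f) k ->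
  learnable Q o S (U `&` Hv) (depth t + k).
Proof.
move=> + L1 L0; elim: t Hv => [|q l IHl r IHr] Hv /=.
  case=> sHv; [apply: learnable_sub L1 _ _ | apply: learnable_sub L0 _ _] => //.
    exact: setIS.
  by apply: setIS => h /sHv[].
case=> Qq /IHl[tl [Ql dl Ul]] /IHr[tr [Qr dr Ur]].
exists (Ask q tl tr); split=> //=.
  by rewrite addSn ltnS addn_maxl geq_max !leq_max dl dr orbT.
by move=> h [Uh Hh] x Sx; case oq : (o q h); [apply: Ur | apply: Ul].
Qed.

End Strategies.

(** * Datasets as images of ordinals, and the halving strategy *)

Lemma card_eq_ordP (X : Type) (S : set X) n : (S #= `I_n)%card ->
  exists2 e : 'I_n -> X, injective e & S = range e.
Proof.
move=> /pcard_eqP/unsquash g.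
have /choice[e eP] : forall i : 'I_n, exists x, S x /\ g x = i.
  by move=> i; have [x Sx gx] := 'surj_g (ltn_ord i); exists x.
exists e => [i j eij|].
  by apply: val_inj; rewrite /= -(eP i).2 -(eP j).2 eij.
apply/seteqP; split=> [x Sx|_ [i _ <-]]; last exact: (eP i).1.
have lt : g x < n := 'funS_g Sx.
exists (Ordinal lt) => //.
have [Se ge] := eP (Ordinal lt); by apply: 'inj_g; rewrite ?inE.
Qed.

Lemma card_eq_image_fset (X : Type) n (e : 'I_n -> X) (A : {set 'I_n}) :
  injective e -> (e @` [set` A] #= `I_#|A|)%card.
Proof.
move=> injE; have -> : e @` [set` A] = range (e \o (fun k : 'I_#|A| => enum_val k)).
  apply/seteqP; split=> [_ [i Ai <-]|_ [k _ <-]]; last first.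
    by exists (enum_val k) => //=; exact: enum_valP.
  by exists (enum_rank_in Ai i); rewrite //= enum_rankK_in.
apply: card_eq_trans (inj_card_eq _) _; last by rewrite card_eq_sym; exact: card_II.
by move=> i j _ _ /injE/enum_val_inj.
Qed.

(** Allows a tree chosen from the dataset alone to meet the bound for whichever [s] is the
    dimension. *)
Lemma query_dimension_uniq X (H : set (hypothesis X)) Q ans n s s' :
  query_dimension H Q ans n s -> query_dimension H Q ans n s' -> s = s'.
Proof.
have le t t' : query_dimension H Q ans n t -> query_dimension H Q ans n t' -> t <= t'.
  move=> [[S [f [cS pf [[T HT dT] minT]]]] _] [_ /(_ S f cS pf)[k [[T' HT' <-] _]]].
  by apply: leq_trans; exact: minT.
by move=> qs qs'; apply/eqP; rewrite eqn_leq !le.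
Qed.

Lemma learnable_le1 X (H : set (hypothesis X)) Q o n (e : 'I_n -> X)
    (V : {set {set 'I_n}}) k :
  #|V| <= 1 -> learnable Q o (range e) [set h | H h /\ trace e h \in V] k.
Proof.
(* The remaining targets share one trace, so on the dataset any one of them gives the right
   labels. *)
move=> le1; exists (Stop (fun x => `[< exists h, [/\ H h, trace e h \in V & h x] >])).
split=> // h [Hh hV] _ [i _ <-] /=.
apply/asboolP/idP => [[h' [_ h'V]]|hi]; last by exists h.
have /setP/(_ i) : trace e h' = trace e h by rewrite (card_le1_eqP le1 _ _ hV h'V).
by rewrite !inE => ->.
Qed.

(** Each round spends at most [s] queries and cuts [V] to at most 3/4 of its size; the numeric
    hypothesis reads [#|V| <= (4/3)^k]. *)
Lemma learnable_halving X (H : set (hypothesis X)) Q o s n (e : 'I_n -> X) :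
    injective e ->
    (forall f, partial_labeling (range e) f ->
       exists2 t, teaching_tree H Q o f t & depth t <= s) ->
  forall k (V : {set {set 'I_n}}), 3 ^ k * #|V| <= 4 ^ k ->
  learnable Q o (range e) [set h | H h /\ trace e h \in V] (k * s).
Proof.
move=> injE teach k V; elim: k V => [|k IHk] V; have [le1 _|gt1 leV] := leqP #|V| 1.
- exact: learnable_le1.
- by move: leV; rewrite mul1n leqNgt gt1.
- exact: learnable_le1.
have [g /andP[ge4 le4]] := balanced_partial_labeling gt1.
(* Transports [g] from indices to points of [X], undefined off the dataset. *)
pose f x := if [pick i | `[< e i = x >]] is Some i then g i else None.
have fE i : f (e i) = g i.
  by rewrite /f; case: pickP => [j /asboolP/injE->//|/(_ i)/asboolP[]].
have Sf : partial_labeling (range e) f.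
  move=> x /=; rewrite /f; case: pickP => [i /asboolP<- _|//].
  by exists i.
have fP h : H h -> extensions H f h <-> extends_labels g (trace e h).
  move=> Hh; split=> [[_ hf]|/forallP hg].
    apply/forallP => i; case gi : (g i) => [b|//].
    by rewrite inE (hf _ b) // fE.
  split=> // x b fx; have [i _ xi] : range e x by apply: Sf; rewrite /= fx.
  by have := hg i; rewrite -fE xi fx inE xi => /eqP.
have [t tH ts] := teach _ Sf.
pose W := [set A in V | extends_labels g A]%SET.
have sWV : W \subset V by apply/fintype.subsetP => A; rewrite inE => /andP[].
have cWV : #|V :\: W| = #|V| - #|W| by rewrite cardsD (finset.setIidPr sWV).
(* The upper bound 3/4 on the share of [W] serves the branch extending [f]; the lower bound 1/4
   serves the complement. *)
rewrite -/W in ge4 le4; rewrite !expnS in leV.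
apply: (@learnable_sub _ _ _ _ ([set h | H h /\ trace e h \in V] `&` H)
          _ (depth t + k * s)).
- apply: (learnable_teaching tH).
  + apply: (learnable_sub (IHk W _)) => //; first nia.
    by move=> h [[Hh hV] /(fP _ Hh) ext]; split=> //; rewrite inE hV.
  + apply: (learnable_sub (IHk (V :\: W) _)) => //; first by rewrite cWV; nia.
    move=> h [[Hh hV] ext]; split=> //; rewrite !inE hV andbT /=.
    by apply/negP => /(fP _ Hh).
- by move=> h [].
- by rewrite mulSn leq_add2r.
Qed.

(** An index set shattered by the traces has an image under [e] shattered by [H], hence at most [d]
    elements; [n.+1 ^ d] bounds the number of such sets. *)
Lemma card_traces X (H : set (hypothesis X)) d n (e : 'I_n -> X) :
    injective e -> VC_dimension H d ->
  #|[set A | `[< exists2 h, H h & trace e h = A >]]%SET| <= n.+1 ^ d.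
Proof.
move=> injE [_ vcH]; apply: leq_trans (card_shattered_sets _) _.
have := card_sets_of_card_le 'I_n d; rewrite card_ord; apply: leq_trans.
apply: subset_leq_card; apply/fintype.subsetP => A; rewrite !inE => /forallP shA.
apply: (vcH _ (e @` [set` A])); first exact: card_eq_image_fset.
move=> g; have /implyP := shA (A :&: trace e g)%SET.
rewrite powersetE finset.subsetIl => /(_ isT)/imsetP[C].
rewrite inE => /asboolP[h Hh <-] eC; exists h => // _ [i Ai <-].
by have /finset.setP/(_ i) := eC; rewrite !inE Ai /= andbT.
Qed.

Lemma learnable_log_dimension X (H : set (hypothesis X)) d Q ans n s S :
    0 < n -> VC_dimension H d -> query_dimension H Q ans n s ->
    (S #= `I_n)%card ->
  learnable Q (ans S) S H (3 * (trunc_log 2 n).+1 * d * s).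
Proof.
move=> n0 vcH [_ qd] cS; have [e injE Se] := card_eq_ordP cS.
have := card_traces injE vcH; set V := (V in #|pred_of_set V|) => cV.
apply: (@learnable_sub _ _ _ _ [set h | H h /\ trace e h \in V]) (leqnn _); last first.
  by move=> h Hh; split=> //; rewrite inE; apply/asboolP; exists h.
rewrite [X in learnable _ _ X]Se; apply: learnable_halving => // [f|].
  rewrite -Se => /(qd _ _ cS)[k [[t tH <-] _] les]; by exists t.
(* (4 / 3) ^ 3 >= 2, hence three rounds per factor 2. *)
apply: (@leq_trans (3 ^ (3 * (trunc_log 2 n).+1 * d) * 2 ^ ((trunc_log 2 n).+1 * d))).
  rewrite leq_pmul2l ?expn_gt0 //; apply: leq_trans cV _.
  (* This is [n.+1 <= 2 ^ (trunc_log 2 n).+1] raised to the power [d]; [leq_exp2r] needs a positive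
     exponent, so [d = 0] is separate. *)
  by rewrite expnM; case: (d) => // j; rewrite leq_exp2r // trunc_log_ltn.
by rewrite -!mulnA !(expnM _ 3) -expnMn; case: (_ * d) => // j; rewrite leq_exp2r.
Qed.

(** * The two bounds for learners, with an explicit constant *)

Local Open Scope ring_scope.

Theorem theoremD4 (R : realType) :
  exists2 C : R, 0 < C &
  forall (X : Type) (H : set (hypothesis X)) (d : nat)
         (Q : set (region_query X)) (L : set X -> set X)
         (ans : set X -> region_query X -> hypothesis X -> bool),
  VC_dimension H d -> labeler L ans ->
  (forall (n s : nat), (0 < n)%N -> query_dimension H Q ans n s ->
   forall A : active_learner Q,
   exists2 S : set X, (S #= `I_n)%card &
     (forall h, H h -> exists m g, outcome ans A S h m g /\ (m < s)%N) ->
     exists h x m g, [/\ H h, S x, outcome ans A S h m g & g x <> h x])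
  /\
  (exists A : active_learner Q,
   forall (n s : nat), (0 < n)%N -> query_dimension H Q ans n s ->
   forall S : set X, (S #= `I_n)%card ->
   forall h, H h ->
   exists m g,
     [/\ outcome ans A S h m g,
         (1 < n)%N -> m%:R <= C * (s%:R * d%:R * ln n%:R) &
         forall x, S x -> g x = h x]).
Proof.
have ln2 : 0 < ln 2 :> R by apply: ln_gt0; rewrite ltr1n.
(* A factor 3 for three rounds per factor 2, a factor 2 from
   [(trunc_log 2 n).+1 <= 2 * trunc_log 2 n], and [ln 2] from the change of base. *)
exists (6 / ln 2); first by rewrite divr_gt0.
move=> X H d Q L ans vcH _; split.
  (* [S] and [f] attain the maximum; a fast learner without errors would unroll on [S] into a
     teaching tree for [f] of depth below [s]. *)
  move=> n s n0 [[S [f [cS Sf [_ mins]]]] _] A; exists S => // fast.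
  have [//|noerr] := pselect (exists h x m g,
    [/\ H h, S x, outcome ans A S h m g & g x <> h x]).
  have [h0 Hh0] : H !=set0.
    by have [[B _ /(_ (fun=> true))[h Hh _]] _] := vcH; exists h.
  have s0 : (0 < s)%N by have [m [_ [_ /(leq_ltn_trans (leq0n m))]]] := fast _ Hh0.
  have := mins (unroll (act A S) s.-1 [::]); rewrite leqNgt.
  case/(_ _)/negP; last first.
    by rewrite -[s in (_ < s)%N](ltn_predK s0) ltnS; exact: depth_unroll.
  apply: teaching_subtree_unroll Sf _ _ => // [v q|h Hh]; first exact: act_query.
  have [m [g [r ms]]] := fast _ Hh; exists m, g; split=> //.
    by rewrite -ltnS (ltn_predK s0).
  move=> x Sx; apply: contrapT => neq; apply: noerr; by exists h, x, m, g.
(* The tree is chosen per dataset, before [n] and [s] are given; where no dimension exists, any tree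
   will do. *)
have /choice[t tP] : forall S, exists t, asks_within Q t /\
    forall n s, (0 < n)%N -> query_dimension H Q ans n s -> (S #= `I_n)%card ->
      (decision_depth t <= 3 * (trunc_log 2 n).+1 * d * s)%N /\
      forall h, H h -> forall x, S x -> decide (fun q => ans S q h) t x = h x.
  move=> S; have [[n [s [n0 qs cS]]]|none] := pselect (exists n s,
    [/\ (0 < n)%N, query_dimension H Q ans n s & (S #= `I_n)%card]).
    have [t [Qt dt tH]] := learnable_log_dimension n0 vcH qs cS.
    exists t; split=> // n' s' _ qs' cS'.
    have nn' : n = n'.
      by apply/card_eq_II; apply: card_eq_trans cS'; rewrite card_eq_sym.
    by subst n'; rewrite (query_dimension_uniq qs' qs).
  exists (Stop (fun=> true)); split=> // n s n0 qs cS.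
  by exfalso; apply: none; exists n, s.
pose A := @ActiveLearner X Q (fun S => follow (t S))
  (fun S w q => @follow_query _ _ _ _ _ (tP S).1).
exists A => n s n0 qs S cS h Hh.
have [dt tH] := (tP S).2 _ _ n0 qs cS.
have [//|m lem r] := @run_follow _ (fun q => ans S q h) (follow (t S)) [::] (t S).
exists m, (decide (fun q => ans S q h) (t S)); split=> // [n1|]; last exact: tH.
have le6 : (m <= 6 * (s * d * trunc_log 2 n))%N.
  (* Here [1 < n] matters: the logarithm is at least 1 and absorbs the successor. *)
  have : (0 < trunc_log 2 n)%N by rewrite trunc_log_gt0.
  move: (leq_trans lem dt); set l := trunc_log 2 n; nia.
apply: (@le_trans _ _ (6 * (s * d * trunc_log 2 n))%N%:R); first by rewrite ler_nat.
rewrite !natrM -[leRHS]mulrA; apply: ler_wpM2l => //.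
rewrite mulrCA; apply: ler_wpM2l; first by rewrite mulr_ge0.
(* What remains is the logarithm of [2 ^ trunc_log 2 n <= n]. *)
rewrite mulrC ler_pdivlMr // mulr_natl -lnXn // ler_ln ?posrE ?exprn_gt0 ?ltr0n //.
by rewrite -natrX ler_nat trunc_logP.
Qed.
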